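(* For every convex body $K\subseteq\mathbb R^n$ with $0\in\operatorname{int}K$ and every $q\geq1$, $$\lim_{\lambda\to\infty}D_q(\lambda K)=1.$$
   Context: A convex body is a compact convex subset of $\mathbb R^n$ with non-empty interior. $(e_i)_{i=1}^n$ is the canonical basis of $\mathbb R^n$, $B_2^n$ is the closed Euclidean unit ball, $O(n)$ is the group of orthogonal $n\times n$ matrices. For a bounded set $L\subseteq\mathbb R^n$, $G_n(L)$ is the cardinality of $L\cap\mathbb Z^n$. Put $C_n=(-1,1)^n$; sums of sets are Minkowski sums. For a convex body $L\subseteq\mathbb R^n$ with $\max_{x\in L\cap\mathbb Z^n}|\langle x,e_n\rangle|\geq 1$ and $p\geq1$, define $$D_0(L,p):=\frac{1+\left(\mathbb E|\langle Y,e_n\rangle|^p\right)^{\frac1p}\left(\frac{G_n(L+C_n)}{G_n(L)}\right)^{\frac1p}}{\left(\mathbb E|\langle X,e_n\rangle|^p\right)^{\frac1p}},$$ where $X$ is uniformly distributed on the finite set $L\cap\mathbb Z^n$ and $Y$ is uniformly distributed on the finite set $(L+C_n)\cap\mathbb Z^n$. For a convex body $L\subseteq\mathbb R^n$ with $B_2^n\subseteq L$ and $q\geq1$, define $$D_q(L):=\sup_{U\in O(n),\ 1\leq p\leq q}D_0(UL,p)$$ (this is well defined since $e_n\in UL\cap\mathbb Z^n$ for every $U\in O(n)$). If $0\in\operatorname{int}K$, then $B_2^n\subseteq\lambda K$ for all sufficiently large $\lambda>0$, so $D_q(\lambda K)$ is defined for all sufficiently large $\lambda$. *)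

(* Defs.v *)
From HB Require Import structures.
From mathcomp Require Import all_boot all_order all_algebra.
From mathcomp Require Import finmap.
From mathcomp Require Import all_classical all_reals all_analysis.

Set Implicit Arguments.
Unset Strict Implicit.
Unset Printing Implicit Defensive.

Import Order.TTheory GRing.Theory Num.Theory.
Import numFieldNormedType.Exports.

Local Open Scope classical_set_scope.
Local Open Scope ring_scope.

Section Definitions.
Variables (R : realType) (n : nat).

(* The dimension is n.+1, so that it is positive and the last canonical basis
   vector exists.  The library topology on column vectors comes from the
   sup norm, hence is the Euclidean one. *)
Local Notation V := 'cV[R]_n.+1.

Definition convex_body (K : set V) : Prop :=
  [/\ compact K, convex_set K & K° !=set0].

Definition inner (x y : V) : R := \sum_(i < n.+1) x i 0 * y i 0.

Definition e_last : V := delta_mx ord_max 0.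

Definition int_lattice : set V := [set x | forall i, x i 0 \is a Num.int].

Definition open_cube : set V := [set x | forall i, -1 < x i 0 < 1].

Definition minkowski_sum (A B : set V) : set V :=
  [set x + y | x in A & y in B].

Definition dilate (a : R) (A : set V) : set V := [set a *: x | x in A].

Definition linear_image (U : 'M[R]_n.+1) (A : set V) : set V :=
  [set U *m x | x in A].

Definition orthogonal_group : set 'M[R]_n.+1 := [set U | U^T *m U = 1%:M].

(* [fset_set] is set0 on infinite sets; it is only used here on the integer
   points of bounded sets. *)
Definition lattice_points (L : set V) : {fset V} :=
  fset_set (L `&` int_lattice).

Definition lattice_count (L : set V) : nat := #|` lattice_points L|.

(* The expectation of f X, for X uniformly distributed on lattice_points L. *)
Definition lattice_mean (L : set V) (f : V -> R) : R :=
  (\sum_(x <- lattice_points L) f x) / (lattice_count L)%:R.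

(* (E |<X, e_n>|^p)^(1/p), for X uniformly distributed on lattice_points L. *)
Definition lattice_moment (L : set V) (p : R) : R :=
  lattice_mean L (fun x => `|inner x e_last| `^ p) `^ p^-1.

(* Meaningful when L is bounded, p >= 1 and L contains an integer point x with
   |<x, e_n>| >= 1, so that the denominator is positive. *)
Definition D0 (L : set V) (p : R) : R :=
  let LC := minkowski_sum L open_cube in
  (1 + lattice_moment LC p *
       ((lattice_count LC)%:R / (lattice_count L)%:R) `^ p^-1)
  / lattice_moment L p.

(* Meaningful when L is a convex body containing the closed Euclidean unit
   ball.  The supremum is taken in the extended reals, so that no boundedness
   is presupposed. *)
Definition Dq (q : R) (L : set V) : \bar R :=
  ereal_sup [set (D0 (linear_image U L) p)%:E
            | U in orthogonal_group & p in [set p : R | 1 <= p <= q]].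

End Definitions.

(* Main.v *)
Require Import Defs.
From HB Require Import structures.
From mathcomp Require Import all_boot all_order all_algebra.
From mathcomp Require Import finmap.
From mathcomp Require Import all_classical all_reals all_analysis.
From mathcomp Require Import zify ring lra.

Set Implicit Arguments.
Unset Strict Implicit.
Unset Printing Implicit Defensive.

Import Order.TTheory GRing.Theory Num.Theory.
Import numFieldNormedType.Exports.

Local Open Scope classical_set_scope.
Local Open Scope ring_scope.

(* Let N = G_n(L), d the dimension, and suppose L contains the sup-norm ball of
   radius r and lies in the one of radius A r.  No volume is needed: since
   x |-> floor (s x + v) is at most m^d to one on Z^d when m s >= 1, one gets
   - by rounding s_j y for J ~ r / 6 scales s_j in [1/2, 1], which sends
     (L + C_n) \ L into pairwise disjoint shells of L, that (L + C_n) \ L has at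
     most 2^d N / J lattice points;
   - by rounding x / 4 + (r / 2) e_n, that a fraction at least 1 / (4^d + 1) of
     the lattice points x of L satisfies |x_n| >= r / 8.
   Hence E |X_n|^p grows like r^p, and summing |y_n|^p over L + C_n instead of L
   changes the sum by a factor 1 + O(1/r), which gives 1 <= D_0(L, p) <= 1 + O(1/r)
   with a constant depending only on d, A and q.  For L = lambda U K one may take
   r proportional to lambda and A independent of U. *)

(** * Sup-norm boxes, convexity, and counting by rounding *)

Definition sup_box (R : realType) (n : nat) (r : R) : set 'cV[R]_n.+1 :=
  [set x | forall i, `|x i 0| <= r].

Definition floor_vec (R : realType) (n : nat) (x : 'cV[R]_n.+1) :
  'cV[R]_n.+1 := \col_i (Num.floor (x i 0))%:~R.

Lemma int_lattice_floor_vec (R : realType) (n : nat) (x : 'cV[R]_n.+1) :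
  int_lattice (floor_vec x).
Proof. by move=> i; rewrite mxE. Qed.

Lemma floor_vec_bounds (R : realType) (n : nat) (x : 'cV[R]_n.+1) i :
  x i 0 - 1 < floor_vec x i 0 <= x i 0.
Proof.
rewrite mxE floor_le andbT.
by have := floorD1_gt (x i 0); rewrite intrD; lra.
Qed.

(** For [a < 1], [v] is [1 - a] times a point of the box, so the sum is a convex combination of two
    points of [L]; for [a = 1] the bound forces [v = 0]. Contracting by [a] thus leaves room
    [(1 - a) * r] for a rounding error. *)
Lemma convex_box_absorb (R : realType) (n : nat) (L : set 'cV[R]_n.+1)
    (r a : R) (x v : 'cV[R]_n.+1) :
    convex_set L -> sup_box r `<=` L -> 0 <= a <= 1 -> L x ->
    sup_box ((1 - a) * r) v ->
  L (a *: x + v).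
Proof.
move=> cL rL /andP[a0 a1] Lx vr.
have [a1'|a1'] := eqVneq a 1.
  suff -> : v = 0 by rewrite a1' scale1r addr0.
  apply/colP => i; have := vr i; rewrite a1' subrr mul0r normr_le0 mxE.
  by move/eqP.
have a_lt1 : 0 < 1 - a by rewrite subr_gt0 lt_neqAle a1'.
have Lw : L ((1 - a)^-1 *: v).
  apply: rL => i; rewrite mxE normrM gtr0_norm ?invr_gt0//.
  by rewrite ler_pdivrMl.
have := cL x _ (Itv01 a0 a1) (mem_set Lx) (mem_set Lw).
move=> /set_mem; rewrite /conv/=.
by rewrite scalerA mulfV ?scale1r// gt_eqF.
Qed.

Lemma finite_lattice_box (R : realType) (n : nat) (r : R) :
  finite_set (sup_box r `&` @int_lattice R n).
Proof.
pose M := `|Num.floor r|%N.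
pose g (f : {ffun 'I_n.+1 -> 'I_(M + M).+1}) : 'cV[R]_n.+1 :=
  \col_i ((f i)%:R - M%:R).
apply: (@sub_finite_set _ _ [set g f | f in [set: {ffun 'I_n.+1 -> 'I_(M + M).+1}]]); last first.
  exact/finite_image/finite_finset.
move=> x [xr xi].
exists [ffun i => inord `|(Num.floor (x i 0) + M%:Z)%R|%N] => //.
apply/colP => i; rewrite mxE ffunE.
have /= := xr i.
have /intrP[z ->] := xi i.
rewrite intrKfloor -intr_norm -floor_ge_int => zr.
have zM : (`|z| <= M)%N by move: zr; rewrite /M; move: (Num.floor r) => k; lia.
rewrite inordK; last by lia.
have e : ((`|(z + M%:Z)%R|%N)%:Z = z + M%:Z)%R by lia.
by rewrite -[X in X - _]/((`|(z + M%:Z)%R|%N)%:Z%:~R) e intrD addrK.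
Qed.

Lemma finite_lattice (R : realType) (n : nat) (r : R) (L : set 'cV[R]_n.+1) :
  L `<=` sup_box r -> finite_set (L `&` @int_lattice R n).
Proof.
by move=> Lr; apply: (sub_finite_set _ (finite_lattice_box n r)); exact: setSI.
Qed.

Lemma mem_lattice_points (R : realType) (n : nat) (r : R)
    (L : set 'cV[R]_n.+1) x :
  L `<=` sup_box r -> x \in lattice_points L <-> L x /\ int_lattice x.
Proof.
move=> Lr; rewrite in_fset_set; last exact: finite_lattice Lr.
by split=> [/set_mem //|?]; apply/mem_set.
Qed.

(* A point is determined by its image together with its residues mod m. *)
Lemma card_floor_contraction (R : realType) (n m : nat)
    (S T : {fset 'cV[R]_n.+1}) (s : R) (v : 'cV[R]_n.+1) :
    1 <= m.+1%:R * s -> (forall x, x \in S -> int_lattice x) ->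
    (forall x, x \in S -> floor_vec (s *: x + v) \in T) ->
  (#|` S| <= m.+1 ^ n.+1 * #|` T|)%N.
Proof.
move=> ms Si ST.
pose res (x : 'cV[R]_n.+1) : {ffun 'I_n.+1 -> 'I_m.+1} :=
  [ffun i => inord `|(Num.floor (x i 0%R) %% m.+1)%Z|%N].
pose F x := (floor_vec (s *: x + v), res x).
pose U := [seq (a, b) | a <- (T : seq _), b <- enum {ffun 'I_n.+1 -> 'I_m.+1}].
have s0 : 0 < s.
  by rewrite -(pmulr_rgt0 _ (ltr0Sn R m)); apply: lt_le_trans ms.
have szU : size U = (m.+1 ^ n.+1 * #|` T|)%N.
  by rewrite size_allpairs -cardE card_ffun !card_ord mulnC.
rewrite -szU -(size_map F); apply: uniq_leq_size; last first.
  move=> _ /mapP[x xS ->]; apply/allpairsP.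
  by exists (F x); split; rewrite ?mem_enum ?ST.
rewrite map_inj_in_uniq ?fset_uniq// => x y xS yS [fxy rxy].
apply/colP => i.
have {}fxy : floor_vec (s *: x + v) i 0 = floor_vec (s *: y + v) i 0 by rewrite fxy.
have := floor_vec_bounds (s *: x + v) i.
have := floor_vec_bounds (s *: y + v) i.
rewrite fxy; set z := floor_vec _ _ _; rewrite !mxE => hy hx.
(* Equal floors put the images at distance below 1 in coordinate [i], so [x] and [y] differ there by
   less than 1/s, which is at most m + 1. *)
have {hx hy}xy : `|x i 0 - y i 0| < m.+1%:R.
  have h : `|s * (x i 0 - y i 0)| < 1 by rewrite real_ltr_norml ?num_real//; lra.
  rewrite normrM gtr0_norm// in h.
  rewrite -(ltr_pM2l s0); apply: lt_le_trans h _.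
  by rewrite mulrC.
move: rxy => /ffunP/(_ i); rewrite !ffunE => /(congr1 val) /=.
have /intrP[a ea] := Si x xS i.
have /intrP[b eb] := Si y yS i.
move: xy; rewrite ea eb !intrKfloor.
rewrite -intrB -intr_norm -[m.+1%:R]/(m.+1%:Z%:~R) ltr_int => ab.
rewrite !inordK; try lia.
move=> h; congr (_%:~R); move: ab h; clear => ab h.
have {}h : (a %% m.+1)%Z = (b %% m.+1)%Z by lia.
(* Equal residues and a difference smaller than the modulus force equal quotients. *)
have := divz_eq a m.+1; have := divz_eq b m.+1; rewrite h.
move: ab; set k := (a %/ _)%Z; set l := (b %/ _)%Z; set t := (_ %% _)%Z.
move=> ab eb ea; rewrite ea eb in ab *.
suff -> : k = l by [].
have : (`|k - l| * m.+1%:Z < m.+1%:Z)%R by lia.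
nia.
Qed.

(** * Lattice points in the boundary layer and in the slab around x_n = 0 *)

Lemma sup_box_dilate (R : realType) (n : nat) (L : set 'cV[R]_n.+1)
    (M t : R) :
  0 <= t <= 1 -> L `<=` sup_box M -> dilate t L `<=` sup_box M.
Proof.
move=> /andP[t0 t1] LM _ [x /LM xM <-] i.
rewrite mxE normrM (ger0_norm t0); apply: le_trans (xM i).
by rewrite ler_piMl.
Qed.

Lemma convex_dilateS (R : realType) (n : nat) (L : set 'cV[R]_n.+1)
    (r s t : R) :
    convex_set L -> sup_box r `<=` L -> 0 <= r -> 0 <= s <= t -> 0 < t ->
  dilate s L `<=` dilate t L.
Proof.
move=> cL rL r0 /andP[s0 st] t0 _ [x Lx <-].
exists ((s / t) *: x + 0); last by rewrite addr0 scalerA mulrCA mulfV ?mulr1// gt_eqF.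
have st1 : 0 <= s / t <= 1 by rewrite divr_ge0 ?(ltW t0)//= ler_pdivrMr// mul1r.
apply: (convex_box_absorb cL rL st1 Lx) => i.
by rewrite mxE normr0 mulr_ge0// subr_ge0; case/andP: st1.
Qed.

(* Rounding s y, for y in (L + C) \ L, gives a lattice point of (s + 2/r) L
   outside (s - 1/r) L. *)
Lemma card_shell_contraction (R : realType) (n : nat) (L : set 'cV[R]_n.+1)
    (r M s : R) (S : {fset 'cV[R]_n.+1}) :
    convex_set L -> sup_box r `<=` L -> L `<=` sup_box M ->
    2^-1 <= s -> s + 2 / r <= 1 -> 2 < r ->
    (forall y, y \in S ->
      [/\ int_lattice y, minkowski_sum L (@open_cube R n) y & ~ L y]) ->
  (#|` S| + 2 ^ n.+1 * lattice_count (dilate (s - r^-1) L) <=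
   2 ^ n.+1 * lattice_count (dilate (s + 2 / r) L))%N.
Proof.
move=> cL rL LM s2 s1 r2 SL.
have r0 : 0 < r by lra.
have ri0 : 0 < r^-1 by rewrite invr_gt0.
have ri2 : r^-1 < 2^-1 by rewrite ltf_pV2 ?posrE; lra.
set a := s - r^-1; set b := s + 2 / r.
have rr : r * r^-1 = 1 by rewrite mulfV ?gt_eqF.
have a01 : 0 <= a <= 1 by apply/andP; split; rewrite /a; lra.
have b01 : 0 <= b <= 1 by apply/andP; split; rewrite /b; lra.
have b0 : 0 < b by rewrite /b; lra.
have ab : 0 <= a <= b by apply/andP; split; rewrite /a /b; lra.
have aM := sup_box_dilate a01 LM.
have bM := sup_box_dilate b01 LM.
have sub : (lattice_points (dilate a L) `<=` lattice_points (dilate b L))%fset.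
  apply/fsubsetP => x /(mem_lattice_points _ aM)[xa xi].
  apply/(mem_lattice_points _ bM); split => //.
  exact: (convex_dilateS cL rL (ltW r0) ab b0).
rewrite /lattice_count addnC -leq_subRL; last by rewrite leq_mul2l fsubset_leq_card ?orbT.
rewrite -mulnBr -cardfsDS//. 
(* Residues mod 2 suffice because [s] is at least 1/2; hence the factor 2^d. *)
apply: (@card_floor_contraction R n 1 _ _ s 0); first by lra.
  by move=> x /SL[].
move=> y /SL[yi [l Ll [c Cc lcy]] nLy].
rewrite addr0; set z := floor_vec _.
have zy i : s * y i 0 - 1 < z i 0 <= s * y i 0.
  by have := floor_vec_bounds (s *: y) i; rewrite -/z mxE.
have zint : int_lattice z := int_lattice_floor_vec _.
clearbody z.
rewrite inE; apply/andP; split.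
  (* If z = a w with w in L, then y = (a/s) w + (y - z/s), and the error y - z/s has sup norm at
     most 1/s, which is exactly (1 - a/s) r. So y would lie in L. *)
  apply/negP => /(mem_lattice_points _ aM)[[w Lw wz] _]; apply: nLy.
  have as1 : 0 <= a / s <= 1.
    rewrite divr_ge0 ?ler_pdivrMr /=; [rewrite /a; lra|lra| |lra].
    by case/andP: a01.
  suff -> : y = (a / s) *: w + (y - s^-1 *: z).
    apply: (convex_box_absorb cL rL as1 Lw) => i.
    rewrite !mxE.
    have -> : y i 0 - s^-1 * z i 0 = s^-1 * (s * y i 0 - z i 0).
      by rewrite mulrBr mulrA mulVf ?mul1r//; lra.
    have -> : (1 - a / s) * r = s^-1.
      by rewrite /a; field; apply/andP; split; lra.
    rewrite normrM ger0_norm; last by rewrite invr_ge0; lra.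
    rewrite ler_piMr ?invr_ge0; [|lra|].
    - by [].
    - by have := zy i; rewrite ler_norml; lra.
  by rewrite -wz scalerA [s^-1 * a]mulrC addrC subrK.
apply/(mem_lattice_points _ bM); split => //.
have sb1 : 0 <= s / b <= 1.
  rewrite divr_ge0 ?ler_pdivrMr//= ?(ltW b0)//; last lra.
  by rewrite /b; lra.
(* With y = l + c, the difference z - s l is a rounding error plus s c, each of sup norm at most 1.
   Their total 2 equals (b - s) r, the room between s L and b L. *)
exists ((s / b) *: l + b^-1 *: (z - s *: l)); last first.
  rewrite scalerDr !scalerA mulrCA mulfV ?gt_eqF// mulr1 scale1r.
  by rewrite addrC subrK.
apply: (convex_box_absorb cL rL sb1 Ll) => i.
have -> : (1 - s / b) * r = b^-1 * 2.
  have bs : (b - s) * r = 2 by rewrite /b addrC addKr divfK// gt_eqF.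
  by rewrite -bs mulrA [b^-1 * _]mulrBr mulVf ?gt_eqF// [s / b]mulrC.
rewrite !mxE normrM ger0_norm ?invr_ge0 ?(ltW b0)// ler_wpM2l// ?invr_ge0 ?(ltW b0)//.
have := zy i; rewrite -lcy mxE.
have /andP[c1 c2] := Cc i.
have sc1 : `|s * c i 0| <= 1.
  rewrite normrM ger0_norm; last lra.
  by rewrite mulr_ile1// ?ler_norml; lra.
move: sc1; rewrite !ler_norml mulrDr; lra.
Qed.

(** The scales s_j = 1 - 3(j + 1)/r make consecutive shells adjacent: the shell of s_j lies between
    the dilates by 1 - (3j + 4)/r and 1 - (3j + 1)/r. The [J] inequalities therefore telescope, and
    6J <= r keeps every s_j at least 1/2. *)
Lemma card_shell (R : realType) (n J : nat) (L : set 'cV[R]_n.+1)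
    (r M : R) (S : {fset 'cV[R]_n.+1}) :
    convex_set L -> sup_box r `<=` L -> L `<=` sup_box M ->
    2 < r -> 6 * J%:R <= r ->
    (forall y, y \in S ->
      [/\ int_lattice y, minkowski_sum L (@open_cube R n) y & ~ L y]) ->
  (J * #|` S| <= 2 ^ n.+1 * lattice_count L)%N.
Proof.
move=> cL rL LM r2 Jr SL.
have r0 : 0 < r by lra.
have ri0 : 0 < r^-1 by rewrite invr_gt0.
have ri2 : r^-1 < 2^-1 by rewrite ltf_pV2 ?posrE; lra.
pose g (k : nat) := lattice_count (dilate (1 - k%:R / r) L).
have telescope j : (j <= J)%N ->
    (j * #|` S| + 2 ^ n.+1 * g (3 * j + 1) <= 2 ^ n.+1 * g 1)%N.
  elim: j => [//|j IH] jJ; apply: leq_trans (IH (ltnW jJ)).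
  rewrite mulSn addnAC addnC leq_add2l.
  pose s : R := 1 - (3 * j.+1)%:R / r.
  have s2 : 2^-1 <= s.
    have : 6 * j.+1%:R <= r.
      by apply: le_trans Jr; rewrite ler_pM2l ?ler_nat.
    move=> jr; rewrite -(ler_pM2r r0) /s mulrBl divfK ?gt_eqF// natrM; lra.
  have s1 : s + 2 / r <= 1.
    have : 0 <= j%:R / r :> R by rewrite divr_ge0 ?(ltW r0).
    by rewrite /s natrM -natr1; lra.
  have := card_shell_contraction cL rL LM s2 s1 r2 SL.
  have -> : s - r^-1 = 1 - (3 * j.+1 + 1)%:R / r by rewrite /s natrD mulrDl mul1r; lra.
  have -> // : s + 2 / r = 1 - (3 * j + 1)%:R / r.
  by rewrite /s !natrD !natrM -natr1; lra.
apply: leq_trans (leq_trans (leq_addr _ _) (telescope J (leqnn J))) _.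
rewrite leq_mul2l; apply/orP; right.
have t01 : 0 <= 1 - 1%:R / r <= 1 by apply/andP; split; lra.
apply/fsubset_leq_card/fsubsetP => x.
move=> /(mem_lattice_points _ (sup_box_dilate t01 LM))[[w Lw <-] xi].
apply/(mem_lattice_points _ LM); split => //.
rewrite -[_ *: _]addr0; apply: (convex_box_absorb cL rL t01 Lw) => i.
by rewrite mxE normr0 mulr_ge0 ?(ltW r0)//; case/andP: t01; lra.
Qed.

(* Rounding x / 4 + (r / 2) e_n sends the lattice points of the thin slab into
   the part of L with large last coordinate. *)
Lemma lattice_count_slab (R : realType) (n : nat) (L : set 'cV[R]_n.+1)
    (r M : R) :
    convex_set L -> sup_box r `<=` L -> L `<=` sup_box M -> 8 <= r ->
  (lattice_count L <= (4 ^ n.+1).+1 *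
    #|` [fset x in lattice_points L | (r / 8 <= `|x ord_max 0|)%R]%fset|)%N.
Proof.
move=> cL rL LM r8.
have r0 : 0 < r by lra.
rewrite /lattice_count -(cardfsID [fset x in lattice_points L | (r / 8 <= `|x ord_max 0|)%R]%fset).
rewrite mulSn; apply: leq_add.
  by apply: fsubset_leq_card; exact: fsubsetIr.
pose v : 'cV[R]_n.+1 := (r / 2) *: delta_mx ord_max 0.
(* Contraction by 1/4 needs residues mod 4, hence 4^d; the extra 1 in the final factor counts the
   points already outside the slab. *)
apply: (@card_floor_contraction R n 3 _ _ 4^-1 v).
- by lra.
- by move=> x; rewrite inE => /andP[_ /(mem_lattice_points _ LM)[]].
move=> x; rewrite !inE => /andP[h xL]; move: h; rewrite xL /= -ltNge => xr.
have [Lx xi] := (mem_lattice_points _ LM).1 xL.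
set z := floor_vec _.
have zy i : 4^-1 * x i 0 + v i 0 - 1 < z i 0 <= 4^-1 * x i 0 + v i 0.
  by have := floor_vec_bounds (4^-1 *: x + v) i; rewrite -/z !mxE.
have zint : int_lattice z := int_lattice_floor_vec _.
clearbody z.
have vE i : v i 0 = if i == ord_max then r / 2 else 0.
  by rewrite !mxE eqxx andbT; case: eqP => _; rewrite ?mulr1 ?mulr0.
apply/andP; split.
  apply/(mem_lattice_points _ LM); split=> //.
  (* The translation by r/2 and the rounding error together stay within (1 - 1/4) r, since r >=
     8. *)
  have q01 : (0 <= 4^-1 :> R) && (4^-1 <= 1 :> R) by apply/andP; split; lra.
  have -> : z = 4^-1 *: x + (z - 4^-1 *: x) by rewrite addrC subrK.
  apply: (convex_box_absorb cL rL q01 Lx) => i.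
  rewrite !mxE ler_norml; move: (zy i); rewrite vE; case: ifP => _; lra.
(* In the slab |x_n| < r/8, so z_n exceeds r/2 - r/32 - 1, which is at least r/8. *)
have := zy ord_max; rewrite vE eqxx => /andP[+ _].
move: xr; rewrite ltr_norml ler_normr => /andP[? ?] ?; apply/orP; left; lra.
Qed.

(** * Power sums, moments, and two-sided bounds on [D0] *)

Lemma inner_e_last (R : realType) (n : nat) (x : 'cV[R]_n.+1) :
  inner x (e_last R n) = x ord_max 0.
Proof.
rewrite /inner (bigD1 ord_max)//= big1 ?addr0 ?mxE ?eqxx ?mulr1//.
by move=> i /negbTE iN; rewrite mxE iN mulr0.
Qed.

Lemma ler_sum_fset_const (R : realType) (T : choiceType) (S : {fset T})
    (f : T -> R) (c : R) :
  (forall x, x \in S -> f x <= c) -> \sum_(x <- S) f x <= #|` S|%:R * c.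
Proof.
move=> fc; rewrite mulr_natl -sum1_size -sumrMnr big_seq [leRHS]big_seq.
exact: ler_sum.
Qed.

Lemma ger_sum_fset_const (R : realType) (T : choiceType) (S : {fset T})
    (f : T -> R) (c : R) :
  (forall x, x \in S -> c <= f x) -> #|` S|%:R * c <= \sum_(x <- S) f x.
Proof.
move=> fc; rewrite -lerN2 -sumrN -mulrN; apply: ler_sum_fset_const => x xS.
by rewrite lerN2 fc.
Qed.

Lemma ler_powR_inv (R : realType) (a b p : R) :
  0 < p -> 0 <= a -> a `^ p <= b -> a <= b `^ p^-1.
Proof.
move=> p0 a0 ab; have := @ge0_ler_powR R p^-1.
rewrite invr_ge0 (ltW p0) => /(_ isT (a `^ p) b).
rewrite !nnegrE powR_ge0 (le_trans (powR_ge0 _ _) ab) => /(_ isT isT ab).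
by rewrite -powRrM mulfV ?gt_eqF// powRr1.
Qed.

Lemma sum_fset_subset (R : realType) (T : choiceType) (A B : {fset T})
    (f : T -> R) : (A `<=` B)%fset ->
  \sum_(x <- B) f x = \sum_(x <- A) f x + \sum_(x <- (B `\` A)%fset) f x.
Proof.
move=> AB; rewrite (big_fsetID _ (mem A)) /=; congr (_ + _).
- apply: eq_fbigl => x; rewrite !inE/=.
  by case: (boolP (x \in A)) => [/(fsubsetP AB)->|]; rewrite ?andbF.
- by apply: eq_fbigl => x; rewrite !inE/= andbC.
Qed.

(** The left inequality is what [card_shell] requires of the number of shells; the right one turns
    its 1/J into 12/r. *)
Lemma exists_natr_between (R : realType) (r : R) : 12 <= r ->
  exists J : nat, 6 * J%:R <= r <= 12 * J%:R.
Proof.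
move=> r12; exists (Num.truncn (r / 6)).
have : 0 <= r / 6 by lra.
by move=> /truncn_itv /andP[a]; rewrite -[(Num.truncn _).+1%:R]natr1 => b; apply/andP; split; lra.
Qed.

(** [D0 L p] is (1 + m')/m, where m and m' are the p-th roots of the power sums over L and L + C_n,
    both divided by the same N = G_n(L). The lower bound is m <= m'; the upper one adds 1/m <= 8c/r
    to m'/m <= 1 + d, with d = O(1/r) uniformly in p <= q. *)
Lemma D0_bounds (R : realType) (n : nat) (L : set 'cV[R]_n.+1)
    (r A p q : R) (c := (4 ^ n.+1).+1%:R : R) :
    convex_set L -> sup_box r `<=` L -> L `<=` sup_box (A * r) ->
    0 <= A -> 12 <= r -> 1 <= p <= q ->
  1 <= D0 L p <=
    1 + (8 * c + 12 * (2 ^ n.+1)%:R * (8 * (A + 1)) `^ q * c) / r.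
Proof.
move=> cL rL LM A0 r12 /andP[p1 pq].
have r0 : 0 < r by lra.
have p0 : 0 < p by lra.
have c1 : 1 <= c by rewrite /c ler1n.
have c0 : 0 < c by lra.
set LC := minkowski_sum L (@open_cube R n).
have LCM : LC `<=` sup_box ((A + 1) * r).
  move=> _ [l /LM lM [v Cv <-]] i; rewrite mxE.
  have := lM i; have /andP[] := Cv i; rewrite !ler_norml; lra.
pose f (x : 'cV[R]_n.+1) := `|inner x (e_last R n)| `^ p.
have sum_ge0 s : 0 <= \sum_(x <- s) f x by apply: sumr_ge0 => x _; exact: powR_ge0.
have sub : (lattice_points L `<=` lattice_points LC)%fset.
  apply/fsubsetP => x /(mem_lattice_points _ LM)[Lx xi].
  apply/(mem_lattice_points _ LCM); split => //; exists x => //.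
  by exists 0; rewrite ?addr0// => i; rewrite mxE; apply/andP; split; lra.
pose S := (lattice_points LC `\` lattice_points L)%fset.
pose T := [fset x in lattice_points L | r / 8 <= `|x ord_max 0|]%fset.
have NT : (lattice_count L)%:R <= c * #|` T|%:R :> R.
  by rewrite -natrM ler_nat; apply: (lattice_count_slab cL rL LM); lra.
have N0 : 0 < (lattice_count L)%:R :> R.
  rewrite ltr0n cardfs_gt0; apply/fset0Pn; exists 0.
  apply/(mem_lattice_points _ LM); split; last by move=> i; rewrite mxE.
  by apply: rL => i; rewrite mxE normr0 ltW.
have N'0 : 0 < (lattice_count LC)%:R :> R.
  by apply: lt_le_trans N0 _; rewrite ler_nat fsubset_leq_card.
set N : R := (lattice_count L)%:R in NT N0 *.
set N' : R := (lattice_count LC)%:R in N'0 *.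
pose Sg := \sum_(x <- lattice_points L) f x.
pose SgS := \sum_(x <- S) f x.
have SgE : \sum_(x <- lattice_points LC) f x = Sg + SgS by exact: sum_fset_subset.
have SgS0 : 0 <= SgS by exact: sum_ge0.
(* Only the points of [T] are kept; they form at least a fraction 1/c of the lattice points of L. *)
have Sg_ge : N * (r / 8) `^ p <= c * Sg.
  have : #|` T|%:R * (r / 8) `^ p <= \sum_(x <- T) f x.
    apply: ger_sum_fset_const => x; rewrite !inE => /andP[_ xr].
    rewrite /f inner_e_last; apply: ge0_ler_powR; rewrite ?nnegrE//; lra.
  have TP : (T `<=` lattice_points L)%fset.
    by apply/fsubsetP => x; rewrite !inE => /andP[].
  rewrite /Sg (sum_fset_subset f TP); set u := \sum_(x <- T) _; set w := \sum_(x <- _) _.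
  have w0 : 0 <= w by exact: sum_ge0.
  move=> Tu; apply: (@le_trans _ _ (c * #|` T|%:R * (r / 8) `^ p)).
    by rewrite ler_wpM2r// powR_ge0.
  by rewrite -mulrA ler_wpM2l ?(ltW c0)//; lra.
have Sg0 : 0 <= Sg by exact: sum_ge0.
pose m := lattice_moment L p.
have mE : m = (Sg / N) `^ p^-1 by [].
have m_ge : r / (8 * c) <= m.
  rewrite mE; apply: ler_powR_inv => //; first by rewrite divr_ge0; lra.
  rewrite ler_pdivlMr// invfM mulrA powRM ?invr_ge0 ?divr_ge0; try lra.
  rewrite -mulrA mulrC -mulrA.
  (* As c >= 1 and p >= 1, the power c^(-p) is at most c^(-1). *)
  apply: (@le_trans _ _ (c^-1 * (N * (r / 8) `^ p))).
    rewrite ler_wpM2r ?mulr_ge0 ?powR_ge0 ?(ltW N0)//.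
    by apply: ge1r_powR; rewrite // invr_gt0 c0 invf_le1.
  by rewrite ler_pdivrMl.
have m0 : 0 < m by apply: lt_le_trans m_ge; rewrite divr_gt0; lra.
have [J /andP[J6 J12]] := exists_natr_between r12.
pose B := (8 * (A + 1)) `^ q.
pose d : R := 12 * (2 ^ n.+1)%:R * B * c / r.
have B0 : 0 <= B by exact: powR_ge0.
have d0 : 0 <= d by rewrite /d !mulr_ge0 ?invr_ge0//; lra.
have cardS : J%:R * #|` S|%:R <= (2 ^ n.+1)%:R * N.
  rewrite -!natrM ler_nat; apply: (card_shell cL rL LM) => //; first lra.
  move=> y; rewrite inE => /andP[yP /(mem_lattice_points _ LCM)[yLC yi]].
  split => // Ly; by move/negP: yP; apply; apply/(mem_lattice_points _ LM).
have SgSd : SgS <= d * Sg.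
  have h1 : SgS <= #|` S|%:R * (B * (r / 8) `^ p).
    apply: ler_sum_fset_const => x.
    rewrite inE => /andP[_ /(mem_lattice_points _ LCM)[/LCM/(_ ord_max) xM _]].
    rewrite /f inner_e_last.
    apply: (@le_trans _ _ (((A + 1) * r) `^ p)).
      apply: ge0_ler_powR; rewrite ?nnegrE//; first lra.
      by rewrite mulr_ge0; lra.
    (* Factoring out r/8 makes the bound comparable with [Sg_ge]; the other factor is at least 1, so
       its exponent p may be raised to q. *)
    have -> : (A + 1) * r = (8 * (A + 1)) * (r / 8) by lra.
    rewrite powRM ?mulr_ge0; try lra.
    by rewrite ler_wpM2r ?powR_ge0// ler_powR//; lra.
  have h2 : r * SgS <= 12 * ((2 ^ n.+1)%:R * N) * (B * (r / 8) `^ p).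
    apply: (@le_trans _ _ (12 * J%:R * (#|` S|%:R * (B * (r / 8) `^ p)))).
      by apply: ler_pM => //; lra.
    rewrite mulrA ler_wpM2r// ?mulr_ge0 ?powR_ge0//.
    by rewrite -mulrA ler_wpM2l.
  rewrite /d mulrAC ler_pdivlMr// mulrC; apply: le_trans h2 _.
  have -> : 12 * ((2 ^ n.+1)%:R * N) * (B * (r / 8) `^ p) =
    12 * (2 ^ n.+1)%:R * B * (N * (r / 8) `^ p) by ring.
  rewrite -[leRHS]mulrA; apply: ler_wpM2l => //.
  by rewrite !mulr_ge0.
pose m' := ((Sg + SgS) / N) `^ p^-1.
(* The ratio of counts replaces the normalization of the moment over L + C_n by that over L. *)
have D0E : D0 L p = (1 + m') / m.
  rewrite /D0 -/LC -/m; congr ((1 + _) / _).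
  rewrite /lattice_moment -powRM ?divr_ge0 ?(ltW N0) ?(ltW N'0)//.
  rewrite /lattice_mean SgE -/N -/N' /m'; congr (_ `^ _).
  by rewrite mulrA divfK// gt_eqF.
have pV0 : 0 <= p^-1 by rewrite invr_ge0 ltW.
have mm' : m <= m'.
  rewrite mE /m'; apply: ge0_ler_powR => //; rewrite ?nnegrE ?divr_ge0 ?(ltW N0) ?addr_ge0//.
  by rewrite ler_pM2r ?invr_gt0//; lra.
have m'm : m' <= (1 + d) * m.
  apply: (@le_trans _ _ (((1 + d) * (Sg / N)) `^ p^-1)).
    rewrite /m'; apply: ge0_ler_powR => //; rewrite ?nnegrE ?divr_ge0 ?(ltW N0) ?addr_ge0//.
      by rewrite !mulr_ge0 ?invr_ge0 ?(ltW N0)//; lra.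
    by rewrite mulrA ler_pM2r ?invr_gt0//; lra.
  (* The p-th root of 1 + d is at most 1 + d, since p >= 1. *)
  rewrite powRM ?divr_ge0 ?(ltW N0)//; last lra.
  rewrite -mE ler_wpM2r ?(ltW m0)//; apply: ler1_powR; first lra.
  by rewrite invf_le1.
rewrite D0E; apply/andP; split; first by rewrite ler_pdivlMr//; lra.
rewrite ler_pdivrMr//.
have -> : (8 * c + 12 * (2 ^ n.+1)%:R * (8 * (A + 1)) `^ q * c) / r =
  8 * c / r + d by rewrite mulrDl.
have hm : 1 <= 8 * c / r * m.
  rewrite [8 * c / r * m]mulrAC ler_pdivlMr// mul1r.
  by move: m_ge; rewrite ler_pdivrMr ?mulr_gt0// mulrC.
have -> : (1 + (8 * c / r + d)) * m = 8 * c / r * m + (1 + d) * m by ring.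
exact: lerD.
Qed.

(** * Boxes inside and around rotated dilates, and the limit *)

Lemma compact_sup_box (R : realType) (n : nat) (K : set 'cV[R]_n.+1) :
  compact K -> exists2 M : R, 0 <= M & K `<=` sup_box M.
Proof.
move=> /compact_bounded [M [_ KM]].
exists (`|M| + 1); first by rewrite addr_ge0.
move=> x Kx i; have /= := KM (`|M| + 1) _ x Kx.
have -> : M < `|M| + 1 by have := ler_norm M; lra.
move=> /(_ isT); apply: le_trans; rewrite [leRHS]mx_normrE.
exact: (le_bigmax _ (fun ij => `|x ij.1 ij.2|) (i, 0)).
Qed.

Lemma interior_sup_box (R : realType) (n : nat) (K : set 'cV[R]_n.+1) :
  K° 0 -> exists2 r : R, 0 < r & sup_box r `<=` K.
Proof.
move=> /nbhs_ballP[e /= e0 eK]; exists (e / 2); first by rewrite divr_gt0.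
move=> x xe; apply: eK; split=> // i j; rewrite /ball/= mxE sub0r normrN ord1.
by apply: le_lt_trans (xe i) _; rewrite ltr_pdivrMr// ltr_pMr// ltr1n.
Qed.

(** The diagonal entries of U^T U are the sums of squares of the columns of U. *)
Lemma orthogonal_entry (R : realType) (n : nat) (U : 'M[R]_n.+1) i j :
  @orthogonal_group R n U -> `|U i j| <= 1.
Proof.
move=> UU; have : (U^T *m U) j j = 1 by rewrite UU mxE eqxx.
rewrite mxE (bigD1 i)//= mxE => h.
have : 0 <= \sum_(k < n.+1 | k != i) U^T j k * U k j.
  by apply: sumr_ge0 => k _; rewrite mxE -expr2 sqr_ge0.
rewrite -(@ler_sqr _ `|U i j| 1) ?nnegrE// real_normK ?num_real// expr1n expr2; lra.
Qed.

Lemma mulmx_sup_box (R : realType) (n : nat) (U : 'M[R]_n.+1) (r : R) x :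
  (forall i j, `|U i j| <= 1) -> sup_box r x -> sup_box (n.+1%:R * r) (U *m x).
Proof.
move=> U1 xr i; rewrite mxE; apply: le_trans (ler_norm_sum _ _ _) _.
rewrite mulr_natl -[X in _ *+ X]card_ord -sumr_const; apply: ler_sum => j _.
by rewrite normrM -[leRHS]mul1r ler_pM.
Qed.

Lemma convex_linear_image_dilate (R : realType) (n : nat) (U : 'M[R]_n.+1) (a : R)
    (K : set 'cV[R]_n.+1) :
  convex_set K -> convex_set (linear_image U (dilate a K)).
Proof.
move=> cK _ _ t /set_mem[_ [x Kx <-] <-] /set_mem[_ [y Ky <-] <-].
have /set_mem Kw := cK x y t (mem_set Kx) (mem_set Ky).
apply/mem_set; eexists; first by eexists; first exact: Kw.
by rewrite /conv/= -!scalemxAr mulmxDr scalerDr -!scalemxAr !scalerA ![a * _]mulrC.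
Qed.

(** Both U and its inverse U^T have entries of absolute value at most 1, so each enlarges the sup
    norm by a factor of at most d. The boxes obtained do not depend on U. *)
Lemma linear_image_boxes (R : realType) (n : nat) (U : 'M[R]_n.+1) (a r M : R)
    (K : set 'cV[R]_n.+1) :
    orthogonal_group U -> 0 < a -> sup_box r `<=` K -> K `<=` sup_box M ->
  sup_box (a * (r / n.+1%:R)) `<=` linear_image U (dilate a K) /\
  linear_image U (dilate a K) `<=` sup_box (n.+1%:R * (a * M)).
Proof.
move=> UO a0 rK KM; have U1 i j := orthogonal_entry i j UO.
split=> [x xr|_ [_ [x Kx <-] <-]].
  exists (U^T *m x); last by rewrite mulmxA (mulmx1C UO) mul1mx.
  exists (a^-1 *: (U^T *m x)); last by rewrite scalerA mulfV ?scale1r// gt_eqF.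
  apply: rK => i; rewrite mxE normrM gtr0_norm ?invr_gt0// ler_pdivrMl//.
  have UT1 j k : `|U^T j k| <= 1 by rewrite mxE.
  by have := mulmx_sup_box UT1 xr i; rewrite mulrCA [n.+1%:R * _]mulrC divfK.
apply: mulmx_sup_box => // i; rewrite mxE normrM gtr0_norm//.
by rewrite ler_pM2l//; exact: KM.
Qed.

Theorem lemma1p1 (R : realType) (n : nat) (K : set 'cV[R]_n.+1) (q : R)
    (hK : convex_body K) (hK0 : K° 0) (hq : 1 <= q) :
  Dq q (dilate lambda K) @[lambda --> +oo] --> 1%E.
Proof.
case: hK => /compact_sup_box[M M0 KM] cK _.
have [r r0 rK] := interior_sup_box hK0.
pose s := r / n.+1%:R; have s0 : 0 < s by rewrite divr_gt0.
(* Ratio of the outer box to the inner one, the same for every dilation factor and every U. *)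
pose A := n.+1%:R * M / s.
have A0 : 0 <= A by rewrite divr_ge0 ?mulr_ge0// ltW.
pose c := (4 ^ n.+1).+1%:R : R.
pose C := 8 * c + 12 * (2 ^ n.+1)%:R * (8 * (A + 1)) `^ q * c.
apply: (@squeeze_cvge _ _ _ _ (cst 1%E) _ (fun a => (1 + C / s * a^-1)%:E)).
- near=> a.
  have as12 : 12 <= a * s.
    by rewrite -ler_pdivrMr//; near: a; exact: nbhs_pinfty_ge.
  have a0 : 0 < a by rewrite -(pmulr_lgt0 _ s0); lra.
  have bounds U p : orthogonal_group U -> 1 <= p <= q ->
      1 <= D0 (linear_image U (dilate a K)) p <= 1 + C / s * a^-1.
    move=> UO pq; have [lo hi] := linear_image_boxes UO a0 rK KM.
    have hiA : linear_image U (dilate a K) `<=` sup_box (A * (a * s)).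
      by have -> // : A * (a * s) = n.+1%:R * (a * M); rewrite /A; field; rewrite gt_eqF.
    have := D0_bounds (@convex_linear_image_dilate R n U a K cK) lo hiA A0 as12 pq.
    by rewrite -/s -/c -/C invfM [a^-1 * _]mulrC mulrA.
  apply/andP; split; last first.
    by apply: ge_ereal_sup => _ [U UO [p /= pq <-]]; rewrite lee_fin; case/andP: (bounds U p UO pq).
  (* The lower bound on the supremum needs one member of the family: U = 1 and p = 1, admissible
     because q >= 1. *)
  have idO : @orthogonal_group R n 1%:M by rewrite /orthogonal_group/= trmx1 mul1mx.
  have q1 : 1 <= (1 : R) <= q by rewrite lexx.
  apply: (@le_trans _ _ (D0 (linear_image 1%:M (dilate a K)) 1)%:E).
    by rewrite lee_fin; case/andP: (bounds _ _ idO q1).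
  by apply: ereal_sup_ubound; exists 1%:M => //; exists 1.
- exact: cvg_cst.
- apply: cvg_EFin; first exact: nearW.
  rewrite -[X in _ --> X]addr0 -[X in _ + X](mulr0 (C / s)).
  apply: cvgD; first exact: cvg_cst.
  apply: cvgMl_tmp; apply/gtr0_cvgV0 => //; exact: nbhs_pinfty_gt.
Unshelve. all: by end_near.
Qed.
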